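(* For any finite connected graph $G$ of order $n\geq 3$ with $s$ support vertices, $$\rho^{o}(G)\leq \frac{n+(\delta'-1)s}{\delta'},$$ where $\delta'$ is the minimum degree taken over all vertices of $G$ that are not pendant vertices.
   Context: Graphs are simple and undirected. The order of $G$ is $|V(G)|$. A pendant vertex is a vertex of degree $1$, and a support vertex is a vertex having at least one pendant vertex in its neighborhood. For a vertex $v$, $N(v)$ denotes its open neighborhood (the set of all its neighbors). A subset $B\subseteq V(G)$ is an open packing in $G$ if $|N(v)\cap B|\leq 1$ for all $v\in V(G)$ (equivalently, $N(u)\cap N(v)=\emptyset$ for all distinct $u,v\in B$). The open packing number $\rho^{o}(G)$ is the maximum cardinality of an open packing in $G$. *)

(* Defs.v *)
From mathcomp Require Import all_boot.

Set Implicit Arguments.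
Unset Strict Implicit.
Unset Printing Implicit Defensive.

(* A finite simple graph is a symmetric irreflexive [e : rel T] on a finType. *)
Section Graph.
Variables (T : finType) (e : rel T).

Definition open_nbhd (v : T) : {set T} := [set u | e v u].

Definition degree (v : T) : nat := #|open_nbhd v|.

Definition pendant (v : T) : bool := degree v == 1.

Definition support_vertex (v : T) : bool :=
  [exists u in open_nbhd v, pendant u].

Definition graph_connected : Prop := forall u v : T, connect e u v.

Definition open_packing (B : {set T}) : bool :=
  [forall v, #|open_nbhd v :&: B| <= 1].

Definition open_packing_number : nat :=
  \max_(B : {set T} | open_packing B) #|B|.

(* The default [#|T|] exceeds every degree of an irreflexive graph, so it is
   returned only when all vertices are pendant. *)
Definition min_nonpendant_degree : nat :=
  \big[minn/#|T|]_(v | ~~ pendant v) degree v.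

End Graph.

(* Main.v *)
(** If [B] is an open packing, every vertex has at most one neighbour in [B], so
    double counting gives [\sum_(v in B) degree v <= n] and shows that [B]
    contains at most [s] pendant vertices.  Each [v] in [B] satisfies
    [delta' <= degree v + (delta' - 1) * pendant v]; summing over [B] gives
    [delta' * #|B| <= n + (delta' - 1) * s]. *)
Require Import Defs.
From mathcomp Require Import all_boot all_order all_algebra.

Set Implicit Arguments.
Unset Strict Implicit.
Unset Printing Implicit Defensive.

Import Order.TTheory GRing.Theory Num.Theory.

Section OpenPacking.
Variables (T : finType) (e : rel T).
Hypothesis e_sym : symmetric e.

(** Both sides count the pairs [(v, u)] with [v] in [B] and [e v u]; [e_sym] lets the count be
    regrouped around [u]. *)
Lemma sum_degree (B : {set T}) :
  \sum_(v in B) degree e v = \sum_u #|open_nbhd e u :&: B|.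
Proof.
under eq_bigr do rewrite /degree -sum1_card big_mkcond.
rewrite exchange_big; apply: eq_bigr => u _ /=.
rewrite -sum1_card [RHS](eq_bigl (fun v => (v \in B) && e u v)).
  by rewrite [RHS]big_mkcondr; apply: eq_bigr => v _; rewrite inE e_sym.
by move=> v; rewrite !inE andbC.
Qed.

Lemma open_packing_sum_degree (B : {set T}) :
  open_packing e B -> \sum_(v in B) degree e v <= #|T|.
Proof.
by move=> /forallP packB; rewrite sum_degree -sum1_card leq_sum.
Qed.

(** Pendant vertices have degree 1, so their number in [B] is a degree sum. After double counting, a
    support vertex contributes at most 1 by the packing property, and any other vertex contributes
    0. *)
Lemma open_packing_card_pendant (B : {set T}) :
  open_packing e B ->
  #|[set v in B | pendant e v]| <= #|[set v | support_vertex e v]|.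
Proof.
move=> /forallP packB; set P := [set v in B | _].
have -> : #|P| = \sum_(v in P) degree e v.
  by rewrite -sum1_card; apply: eq_bigr => v; rewrite inE => /andP[_ /eqP].
rewrite sum_degree -sum1_card [leqRHS]big_mkcond leq_sum // => u _.
rewrite inE; case: ifPn => [_|nsu].
  by apply: leq_trans (packB u); apply/subset_leq_card/setIS/subsetP => v /setIdP[].
rewrite leqn0 cards_eq0 -subset0; apply/subsetP => v.
rewrite inE => /andP[uv /setIdP[_ pv]].
by case/negP: nsu; apply/existsP; exists v; rewrite uv.
Qed.

Lemma min_nonpendant_degree_le (v : T) :
  ~~ pendant e v -> min_nonpendant_degree e <= degree e v.
Proof. by move=> npv; rewrite /min_nonpendant_degree -minEnat -leEnat bigmin_le_cond. Qed.

Lemma connected_degree_gt0 (v : T) :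
  graph_connected e -> 1 < #|T| -> 0 < degree e v.
Proof.
move=> conn T_gt1; have [w] : exists w, w \in [set~ v].
  by apply/card_gt0P; rewrite cardsC1 -ltnS prednK // ltnW.
rewrite !inE => wv; have /connectP[[|u p] /=] := conn v w.
  by move=> _ wE; rewrite wE eqxx in wv.
by case/andP=> vu _ _; apply/card_gt0P; exists u; rewrite inE.
Qed.

Lemma min_nonpendant_degree_gt0 :
  graph_connected e -> 1 < #|T| -> 0 < min_nonpendant_degree e.
Proof.
move=> conn T_gt1; rewrite /min_nonpendant_degree.
apply: (big_ind (fun m => 0 < m)) => [|m n m0 n0|v _].
(* The default value [#|T|] of the minimum, which is the result when every vertex is pendant. *)
- exact: ltnW.
- by rewrite leq_min m0.
- exact: connected_degree_gt0.
Qed.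

Lemma open_packing_number_bound :
  graph_connected e -> 1 < #|T| ->
  open_packing_number e * min_nonpendant_degree e
    <= #|T| + (min_nonpendant_degree e).-1 * #|[set v | support_vertex e v]|.
Proof.
move=> conn T_gt1; have d_gt0 := min_nonpendant_degree_gt0 conn T_gt1.
set d := min_nonpendant_degree e in d_gt0 *.
(* Moving [d] to the right as a floor division isolates the maximum, so that each packing [B] can be
   treated separately; the product form is then restored. *)
rewrite -leq_divRL //; apply/bigmax_leqP => B packB; rewrite leq_divRL //.
apply: leq_trans (_ : \sum_(v in B) (degree e v + d.-1 * pendant e v) <= _).
  rewrite -sum_nat_const leq_sum // => v _.
  have [pv|npv] := boolP (pendant e v).
    by rewrite (eqP pv) muln1 add1n prednK.
  by rewrite muln0 addn0 min_nonpendant_degree_le.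
rewrite big_split -big_distrr /= leq_add ?open_packing_sum_degree //.
rewrite leq_mul2l; apply/orP; right.
apply: leq_trans (open_packing_card_pendant packB).
rewrite -sum1_card big_mkcond [leqRHS]big_mkcond /= leq_sum // => v _.
by rewrite inE; case: (v \in B); case: (pendant e v).
Qed.

End OpenPacking.

Theorem theorem4p4 (T : finType) (e : rel T)
    (e_sym : symmetric e) (e_irr : irreflexive e)
    (e_conn : graph_connected e) (n_ge3 : 3 <= #|T|) :
  let n := #|T| in
  let s := #|[set v | support_vertex e v]| in
  let delta' := min_nonpendant_degree e in
  ((open_packing_number e)%:R
     <= (n%:R + (delta'%:R - 1) * s%:R) / delta'%:R :> rat)%R.
Proof.
have T_gt1 : 1 < #|T| := ltnW n_ge3.
have d_gt0 := min_nonpendant_degree_gt0 e_conn T_gt1.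
cbv zeta; rewrite ler_pdivlMr ?ltr0n //.
(* Since [delta'] is positive, the rational [delta' - 1] is the image of the natural predecessor. *)
rewrite -(natrB _ d_gt0) subn1 -!natrM -natrD.
by rewrite ler_nat open_packing_number_bound.
Qed.
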